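(* For $n\ge 1$, $a_n(21;1\to 3)=2^{n-1}$.
   Context: Standard cycle form of $\sigma\in S_n$: product of disjoint cycles (fixed points included), each cycle starting with its largest element, cycles listed in increasing order of largest elements. The fundamental bijection $\theta:S_n\to S_n$ erases the parentheses of the standard cycle form to give a one-line permutation. For $\pi\in S_n$, $\hat\pi=\theta^{-1}(\pi)$. An arrow pattern $(\nu;H)$ of size $k$: a string $\nu=a_1\dots a_m$ of positive integers and a set $H$ of arrows $b\to c$, with all integers appearing forming $[k]$. $\pi\in S_n$ contains $(\nu;H)$ if there is $X=\{x_1<\dots<x_k\}\subseteq[n]$ with positions $t_1<\dots<t_m$ such that $\pi_{t_1}\cdots\pi_{t_m}=x_{a_1}\cdots x_{a_m}$ and $\hat\pi(x_b)=x_c$ for every arrow $b\to c\in H$; otherwise it avoids it. $a_n(\nu;H)$ = number of $\pi\in S_n$ avoiding $(\nu;H)$. *)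

(* Defs.v *)
From mathcomp Require Import all_boot fingroup perm.

Set Implicit Arguments.
Unset Strict Implicit.
Unset Printing Implicit Defensive.

(* The set [n] is represented by 'I_n, the integer i in [n] being the ordinal
   of value i - 1; S_n is 'S_n, and the one-line notation of pi is
   pi 0, pi 1, ..., pi (n - 1). *)

(* [orbit s x] lists the cycle of x starting at x, namely x, s x, s (s x), ...
   [enum 'I_n] is increasing, so the cycles come by increasing maxima. *)
Definition standard_cycle_form n (s : 'S_n) : seq (seq 'I_n) :=
  [seq orbit s x | x : 'I_n <- enum 'I_n & all (fun y : 'I_n => y <= x) (orbit s x)].

Definition erase_parentheses n (s : 'S_n) : seq 'I_n :=
  flatten (standard_cycle_form s).

Lemma mem_erase_parentheses n (s : 'S_n) (x : 'I_n) :
  x \in erase_parentheses s.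
Proof.
have hP : x \in orbit s x := in_orbit s x.
pose m : 'I_n := [arg max_(i > x in orbit s x) (i : nat)].
have [mx maxm] : m \in orbit s x /\ forall j, j \in orbit s x -> j <= m.
  by rewrite /m; case: arg_maxnP.
have xm : fconnect s m x.
  by rewrite (fconnect_sym (@perm_inj _ s)) fconnect_orbit.
apply/flattenP; exists (orbit s m); last by rewrite -fconnect_orbit.
apply/mapP; exists m => //; rewrite mem_filter mem_enum andbT.
apply/allP => y; rewrite -fconnect_orbit => my; apply: maxm.
by rewrite -fconnect_orbit; apply: connect_trans my; rewrite fconnect_orbit.
Qed.

Lemma standard_cycle_max_inj n (s : 'S_n) (x x' y : 'I_n) :
  all (fun y : 'I_n => y <= x) (orbit s x) ->
  all (fun y : 'I_n => y <= x') (orbit s x') ->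
  y \in orbit s x -> y \in orbit s x' -> x = x'.
Proof.
move=> /allP Mx /allP Mx'; rewrite -!fconnect_orbit => xy x'y.
have symC := fconnect_sym (@perm_inj _ s).
have xx' : fconnect s x x' by apply: connect_trans xy _; rewrite symC.
apply/val_inj/anti_leq/andP; split; [apply: Mx' | apply: Mx];
  by rewrite -fconnect_orbit // symC.
Qed.

Lemma erase_parentheses_uniq n (s : 'S_n) : uniq (erase_parentheses s).
Proof.
rewrite /erase_parentheses /standard_cycle_form; set r := filter _ _.
have -> : [seq orbit s x | x : 'I_n <- r] = [seq [seq y | y <- orbit s x] | x : 'I_n <- r].
  by apply: eq_map => x; rewrite map_id.
apply: (@allpairs_uniq_dep _ (fun=> 'I_n) _ (fun _ y => y)).
- by rewrite filter_uniq // enum_uniq.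
- by move=> x _; apply: orbit_uniq.
move=> _ _ /allpairsPdep[x [y [xr yx ->]]] /allpairsPdep[x' [y' [x'r yx' ->]]].
move=> /= eyy; rewrite -{}eyy in yx' *.
move: xr x'r; rewrite !mem_filter => /andP[Mx _] /andP[Mx' _].
by rewrite (standard_cycle_max_inj Mx Mx' yx yx').
Qed.

Lemma size_erase_parentheses n (s : 'S_n) : size (erase_parentheses s) = n.
Proof.
rewrite -[RHS](size_enum_ord n); apply/perm_size/uniq_perm.
- exact: erase_parentheses_uniq.
- exact: enum_uniq.
by move=> x; rewrite mem_erase_parentheses mem_enum.
Qed.

Lemma nth_erase_parentheses_inj n (s : 'S_n) :
  injective (fun i : 'I_n => nth i (erase_parentheses s) i).
Proof.
move=> i j /=; rewrite (set_nth_default j) ?size_erase_parentheses // => /eqP.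
rewrite nth_uniq ?size_erase_parentheses ?erase_parentheses_uniq //.
by move/eqP/val_inj.
Qed.

(* The permutation whose one-line notation is [erase_parentheses s]. *)
Definition theta n (s : 'S_n) : 'S_n := perm (@nth_erase_parentheses_inj n s).

Lemma cat_prefix_inj (T : eqType) (P : pred T) (t t' r r' : seq T) :
  all P t -> all P t' -> ohead (filter P (take 1 r)) = None ->
  ohead (filter P (take 1 r')) = None ->
  t ++ r = t' ++ r' -> t = t' /\ r = r'.
Proof.
elim: t t' => [|a t IH] [|a' t'] //=.
- by move=> _ /andP[Pa _] + _ er; rewrite er /= take0 /= Pa.
- by move=> /andP[Pa _] _ _ + er; rewrite -er /= take0 /= Pa.
move=> /andP[_ Pt] /andP[_ Pt'] hr hr' [-> e].
by have [-> ->] := IH _ Pt Pt' hr hr' e.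
Qed.

Lemma flatten_blocks_inj n (f g : 'I_n -> seq 'I_n) (r r' : seq 'I_n) :
  {in r, forall x : 'I_n, all (fun y : 'I_n => y < x) (f x)} ->
  {in r', forall x : 'I_n, all (fun y : 'I_n => y < x) (g x)} ->
  sorted ltn (map val r) -> sorted ltn (map val r') ->
  flatten [seq x :: f x | x : 'I_n <- r] = flatten [seq x :: g x | x : 'I_n <- r'] ->
  [seq x :: f x | x : 'I_n <- r] = [seq x :: g x | x : 'I_n <- r'].
Proof.
elim: r r' => [|x r IH] [|x' r'] //= Hf Hg sr sr' [exx']; rewrite -{}exx' in Hg sr' *.
have hd (h : 'I_n -> seq 'I_n) q : path ltn x (map val q) ->
    ohead (filter (fun y : 'I_n => y < x)
      (take 1 (flatten [seq z :: h z | z : 'I_n <- q]))) = None.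
  by case: q => //= z q /andP[xz _]; rewrite take0 /= ltnNge (ltnW xz).
case/(cat_prefix_inj (Hf _ (mem_head _ _)) (Hg _ (mem_head _ _)) (hd _ _ sr) (hd _ _ sr')).
move=> -> e; congr (_ :: _); apply: IH e.
- by move=> z zr; apply: Hf; rewrite inE zr orbT.
- by move=> z zr; apply: Hg; rewrite inE zr orbT.
- exact: path_sorted sr.
- exact: path_sorted sr'.
Qed.

Lemma erase_parentheses_inj n : injective (@erase_parentheses n).
Proof.
move=> s s' es.
have orbE (u : 'S_n) x : orbit u x = x :: behead (orbit u x).
  by rewrite /orbit -orderSpred.
pose mx (u : 'S_n) :=
  [seq x : 'I_n <- enum 'I_n | all (fun y : 'I_n => y <= x) (orbit u x)].
have scfE (u : 'S_n) :
    standard_cycle_form u = [seq x :: behead (orbit u x) | x : 'I_n <- mx u].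
  by apply: eq_map => x; rewrite -orbE.
have small (u : 'S_n) : {in mx u, forall x : 'I_n,
    all (fun y : 'I_n => y < x) (behead (orbit u x))}.
  move=> x; rewrite mem_filter => /andP[/allP M _]; apply/allP => y yb.
  have := orbit_uniq u x; rewrite orbE => /andP[xN _].
  rewrite ltn_neqAle M ?andbT; last by rewrite orbE inE yb orbT.
  by apply/eqP => /ord_inj eyx; case/negP: xN; rewrite -{1}eyx.
have incr (u : 'S_n) : sorted ltn (map val (mx u)).
  rewrite sorted_map; apply: sorted_filter; first by move=> ? ? ?; apply: ltn_trans.
  by rewrite -sorted_map val_enum_ord iota_ltn_sorted.
have escf : standard_cycle_form s = standard_cycle_form s'.
  rewrite !scfE; apply: flatten_blocks_inj; try exact: small; try exact: incr.
  by rewrite -!scfE.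
have nextE (u : 'S_n) c (x : 'I_n) :
    c \in standard_cycle_form u -> x \in c -> u x = next c x.
  case/mapP => y _ -> xy; apply/eqP.
  exact: (next_cycle (cycle_orbit (@perm_inj _ u) y) xy).
apply/permP => x; have /flattenP[c cs xc] := mem_erase_parentheses s x.
by rewrite (nextE _ _ _ cs xc) (nextE s' c) // -escf.
Qed.

Lemma theta_inj n : injective (@theta n).
Proof.
move=> s s' /permP es; apply: erase_parentheses_inj.
case: n s s' es => [|n] s s' es.
  by rewrite !(size0nil (size_erase_parentheses _)).
apply: (@eq_from_nth _ ord0); rewrite ?size_erase_parentheses // => i lti.
have := es (Ordinal lti); rewrite !permE /=.
by rewrite !(set_nth_default ord0 (Ordinal lti)) ?size_erase_parentheses.
Qed.

(* The inverse image of pi under theta, written with a hat over pi. *)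
Definition hat n (pi : 'S_n) : 'S_n := invF (@theta_inj n) pi.

(* Pattern letters keep their 1-based values; (b, c) in [ap_arrows] is the
   arrow b -> c. *)
Record arrow_pattern (k : nat) := ArrowPattern {
  ap_word : seq nat;
  ap_arrows : seq (nat * nat);
  ap_letters : perm_eq
    (undup (ap_word ++ unzip1 ap_arrows ++ unzip2 ap_arrows)) (iota 1 k) }.

Definition increasing m n (f : {ffun 'I_m -> 'I_n}) : bool :=
  [forall i : 'I_m, forall j : 'I_m, (i < j) ==> (f i < f j)].

(* X = {x_1 < ... < x_k} is given by its increasing enumeration; as [x] is
   indexed by 'I_k, the element x_a of the paper is [x] at the ordinal a - 1,
   hence the successors below.  [t] gives the positions t_1 < ... < t_m. *)
Definition contains k n (p : arrow_pattern k) (pi : 'S_n) : bool :=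
  [exists x : {ffun 'I_k -> 'I_n},
   exists t : {ffun 'I_(size (ap_word p)) -> 'I_n},
   [&& increasing x, increasing t,
       [forall i : 'I_(size (ap_word p)), forall a : 'I_k,
          (nth 0 (ap_word p) i == a.+1) ==> (pi (t i) == x a)]
     & [forall b : 'I_k, forall c : 'I_k,
          ((b.+1, c.+1) \in ap_arrows p) ==> (hat pi (x b) == x c)]]].

Definition avoid_count k (n : nat) (p : arrow_pattern k) : nat :=
  #|[set pi : 'S_n | ~~ contains p pi]|.

(* Main.v *)
(* Write s for the preimage of a permutation under the fundamental bijection.
   If s x <= x + 1 for all x then the arrow 1 -> 3 cannot occur.  Conversely, in
   an avoider any y standing after a larger z in the word lies in the cycle of
   z, whose maximum is z (follow the word after z to its last entry below z).
   If s x >= x + 2, avoidance puts x + 1 after x, hence after z = s x, so z is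
   the maximum of its cycle and x closes that cycle; but x + 1 stands later in
   the same cycle.  Finally, composing with the transposition of the two largest
   points preserves the condition s x <= x + 1 and exchanges the permutations
   fixing the largest point with the others, so each step doubles the count. *)

Require Import Defs.
From mathcomp Require Import all_boot fingroup perm.
From mathcomp Require Import zify.

Set Implicit Arguments.
Unset Strict Implicit.
Unset Printing Implicit Defensive.

(** * Positions in the word and cycle maxima *)

Definition pos n (s : 'S_n) (x : 'I_n) : nat := index x (erase_parentheses s).

Definition cycle_max n (s : 'S_n) (x : 'I_n) : 'I_n :=
  [arg max_(m > x in orbit s x) (m : nat)].

Lemma ltn_pos n (s : 'S_n) (x : 'I_n) : pos s x < n.
Proof.
by rewrite -{2}(size_erase_parentheses s) index_mem mem_erase_parentheses.
Qed.

Lemma theta_pos n (s : 'S_n) (x : 'I_n) : theta s (Ordinal (ltn_pos s x)) = x.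
Proof. by rewrite permE /= nth_index // mem_erase_parentheses. Qed.

Lemma pos_inj n (s : 'S_n) : injective (pos s).
Proof. by move=> x y; apply: (index_inj x); apply: mem_erase_parentheses. Qed.

Lemma hat_theta n (s : 'S_n) : hat (theta s) = s.
Proof. exact: invF_f. Qed.

Section StandardForm.

Variables (n : nat) (s : 'S_n).
Implicit Types x y z : 'I_n.

Lemma cycle_max_spec x :
  cycle_max s x \in orbit s x /\ {in orbit s x, forall y, y <= cycle_max s x}.
Proof. by rewrite /cycle_max; case: arg_maxnP => [|m]; first exact: in_orbit. Qed.

Lemma leq_cycle_max x : x <= cycle_max s x.
Proof. by apply: (cycle_max_spec x).2; apply: in_orbit. Qed.

Lemma eq_cycle_max x y : y \in orbit s x -> cycle_max s y = cycle_max s x.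
Proof.
move=> yx; have symC := fconnect_sym (@perm_inj _ s).
have eo : orbit s y =i orbit s x.
  rewrite -!fconnect_orbit in yx *; move=> z.
  by rewrite -!fconnect_orbit (same_connect symC yx).
have [my My] := cycle_max_spec y; have [mx Mx] := cycle_max_spec x.
apply/val_inj/anti_leq/andP; split; first by apply: Mx; rewrite -eo.
by apply: My; rewrite eo.
Qed.

Lemma cycle_max_perm x : cycle_max s (s x) = cycle_max s x.
Proof. by apply: eq_cycle_max; rewrite -fconnect_orbit fconnect1. Qed.

Lemma cycle_max_idem x : cycle_max s (cycle_max s x) = cycle_max s x.
Proof. exact: eq_cycle_max (cycle_max_spec x).1. Qed.

Lemma mem_standard_cycle_form x :
  orbit s (cycle_max s x) \in standard_cycle_form s.
Proof.
apply: map_f; rewrite mem_filter mem_enum andbT.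
by rewrite -{1}cycle_max_idem; apply/allP/(cycle_max_spec _).2.
Qed.

(** The cycle of [x] is a contiguous block of the word starting at its maximum; [s] steps to the
    next entry or, at the end of the block, wraps around. *)
Lemma pos_perm x : s x = cycle_max s x \/ pos s (s x) = (pos s x).+1.
Proof.
have := mem_standard_cycle_form x; set m := cycle_max s x => cm.
(* [a] is the total length of the cycles listed before this one. *)
have [a posE] : exists a, forall i, i < fingraph.order s m -> pos s (iter i s m) = a + i.
  have := erase_parentheses_uniq s; rewrite /pos /erase_parentheses.
  case/splitPr: cm => c d; rewrite flatten_cat /= => uw.
  exists (size (flatten c)) => i lti.
  rewrite -[RHS](index_uniq m _ uw) ?size_cat ?size_orbit ?ltn_add2l ?ltn_addr //.
  by rewrite nth_cat ltnNge leq_addr addKn nth_cat size_orbit lti nth_traject.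
have /trajectP[i lti ->] : x \in traject s m (fingraph.order s m).
  rewrite -/(orbit s m) -fconnect_orbit (fconnect_sym (@perm_inj _ s)).
  by rewrite fconnect_orbit; apply: (cycle_max_spec x).1.
rewrite -iterS; have := lti; rewrite leq_eqVlt => /predU1P[e|lt].
  by left; rewrite e iter_order //; apply: perm_inj.
by right; rewrite !posE ?addnS.
Qed.

(** Whole cycles are listed by increasing maxima and [cycle_max s] is constant on each, so the word
    is sorted for the preorder pulled back along it. *)
Lemma leq_pos_cycle_max x y :
  pos s x <= pos s y -> cycle_max s x <= cycle_max s y.
Proof.
pose r := relpre (cycle_max s) (fun x y : 'I_n => x <= y).
have r_trans : transitive r by move=> ? ? ?; apply: leq_trans.
suff sw : sorted r (erase_parentheses s).
  have r_refl : reflexive r by move=> z; apply: leqnn.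
  by apply: (sorted_leq_index r_trans r_refl sw); apply: mem_erase_parentheses.
rewrite sorted_pairwise // /erase_parentheses /standard_cycle_form.
have rs : sorted ltn (map val (enum 'I_n)) by rewrite val_enum_ord iota_ltn_sorted.
elim: (enum 'I_n) rs => //= z q IH; rewrite path_sortedE; last exact: ltn_trans.
move=> /andP[/allP zq /IH{}IH]; case: ifP => //= /allP Mz.
have zE : cycle_max s z = z.
  apply: val_inj; apply/anti_leq; rewrite leq_cycle_max andbT.
  exact/Mz/(cycle_max_spec z).1.
rewrite pairwise_cat IH andbT; apply/andP; split.
  apply/allrelP => u v /eq_cycle_max zu /flatten_mapP[w].
  rewrite mem_filter => /andP[_ wq] /eq_cycle_max wv.
  rewrite /r /= zu wv zE; apply: leq_trans (leq_cycle_max w).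
  by apply/ltnW/zq/map_f.
apply/(pairwiseP z) => i j lti ltj _.
by rewrite /r /= !(@eq_cycle_max z) // mem_nth.
Qed.

(** If the earliest entry of a cycle were not its maximum, its preimage would stand one place before
    it. *)
Lemma pos_cycle_max_min x : pos s (cycle_max s x) <= pos s x.
Proof.
have: cycle_max s x == cycle_max s x by [].
case: (@arg_minnP _ x (fun y => cycle_max s y == cycle_max s x) (pos s)) => //.
move=> z /eqP zx zmin _.
pose p := (s^-1)%g z.
have sp : s p = z by rewrite permKV.
have px : cycle_max s p = cycle_max s x by rewrite -zx -sp cycle_max_perm.
case: (pos_perm p); rewrite sp; first by move=> ezp; rewrite -px -ezp zmin.
by move=> e; have := zmin p; rewrite px eqxx e => /(_ isT); lia.
Qed.

(** The last entry [z] of the cycle has no later successor, so [s z] is the maximum, which is [s x];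
    injectivity gives [z = x]. *)
Lemma pos_cycle_end_max x y :
  s x = cycle_max s x -> cycle_max s y = cycle_max s x -> pos s y <= pos s x.
Proof.
move=> sx /eqP yx.
case: (@arg_maxnP _ y (fun z => cycle_max s z == cycle_max s x) (pos s)) => //.
move=> z /eqP zx zmax.
case: (pos_perm z) => [|e].
  by rewrite zx -sx => /perm_inj <-; apply: zmax.
by have := zmax (s z); rewrite cycle_max_perm zx eqxx e => /(_ isT); lia.
Qed.

(** * Consequences of avoidance *)

Section Avoid.

(** Here [x], [y], [s x] play the letters 1, 2, 3: an occurrence would have [y] before [x] in the
    word. *)
Hypothesis avoid : forall x y, x < y -> y < s x -> pos s x <= pos s y.

(* The last [y] after [z] with [y < z] closes its cycle: its image cannot
   exceed [z], and is not a smaller later entry. *)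
Lemma avoid_inversion z y :
  pos s z < pos s y -> y < z -> cycle_max s z = z /\ cycle_max s y = z.
Proof.
move=> zy lt_yz.
have Py : (pos s z < pos s y) && (y < z) by rewrite zy.
case: (@arg_maxnP _ y (fun y => (pos s z < pos s y) && (y < z)) (pos s)) => //.
move=> y0 /andP[zy0 lt_y0z] max0.
have le_s : s y0 <= z.
  by rewrite leqNgt; apply/negP => /(avoid lt_y0z); rewrite leqNgt zy0.
have le_z := leq_pos_cycle_max (ltnW zy).
have le_y := leq_pos_cycle_max (max0 _ Py).
have z_le := leq_cycle_max z.
case: (pos_perm y0) => e.
  (* The chain [z <= cycle_max s z <= cycle_max s y <= cycle_max s y0 <= z] collapses. *)
  by rewrite e in le_s; split; apply: val_inj => /=; lia.
have ne : val (s y0) != val z.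
  by apply/eqP => /val_inj es; move: e; rewrite es; lia.
have lt_s : s y0 < z by rewrite ltn_neqAle ne.
by have := max0 (s y0); rewrite lt_s e andbT; lia.
Qed.

Lemma avoid_leq_succ x : s x <= x.+1.
Proof.
rewrite leqNgt; apply/negP => lt_sx.
have lt_n : x.+1 < n by apply: ltn_trans lt_sx _.
pose y : 'I_n := Ordinal lt_n.
have ne_pos u v : val u != val v -> pos s u != pos s v.
  by apply: contra => /eqP/pos_inj->.
have xy : pos s x <= pos s y by apply: avoid.
have nxy : pos s x != pos s y by apply: ne_pos; rewrite /=; lia.
have nsy : pos s (s x) != pos s y by apply: ne_pos; rewrite /=; lia.
have sy : pos s (s x) < pos s y.
  (* Either [s x] opens the cycle of [x], or it directly follows [x] and differs from [y]. *)
  by case: (pos_perm x) => e; [have := pos_cycle_max_min x; rewrite -e|]; lia.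
have [zz yz] := avoid_inversion sy lt_sx.
have sx : s x = cycle_max s x by rewrite -cycle_max_perm zz.
(* [x] ends its cycle, yet [y] lies in that cycle and stands after [x]. *)
by have := pos_cycle_end_max sx; rewrite -sx => /(_ y yz); lia.
Qed.

End Avoid.

End StandardForm.

(** * Translation of the pattern through the fundamental bijection *)

Lemma contains_theta n (s : 'S_n) :
  contains (@ArrowPattern 3 [:: 2; 1] [:: (1, 3)] isT) (theta s) =
  ~~ [forall x : 'I_n, s x <= x.+1].
Proof.
apply/existsP/forallPn => [[f /existsP[t /and4P[incf inct /forallP w a]]]|[x]].
  pose i0 := @Ordinal 3 0 isT; pose i1 := @Ordinal 3 1 isT.
  pose i2 := @Ordinal 3 2 isT.
  have /forallP/(_ i1) := forallP incf i0; rewrite /= => lt01.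
  have /forallP/(_ i2) := forallP incf i1; rewrite /= => lt12.
  have /forallP/(_ i2) := forallP a i0; rewrite /= hat_theta => /eqP e.
  exists (f i0); rewrite e -ltnNge; exact: leq_ltn_trans lt01 lt12.
move=> gt_sx.
have /existsP[x1 /existsP[x2 /and3P[lt12 lt2s pos21]]] :
    [exists x1 : 'I_n, exists x2 : 'I_n,
      [&& x1 < x2, x2 < s x1 & pos s x2 < pos s x1]].
  apply/contraT => /existsPn H; case/negP: gt_sx; apply: avoid_leq_succ => u v uv vu.
  by have /existsPn/(_ v) := H u; rewrite uv vu /= -leqNgt.
exists [ffun i : 'I_3 => nth x1 [:: x1; x2; s x1] i].
(* The word 21 reads the middle value [x2] first, then [x1]. *)
apply/existsP; exists [ffun i : 'I_2 => nth (Ordinal (ltn_pos s x1))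
  [:: Ordinal (ltn_pos s x2); Ordinal (ltn_pos s x1)] i].
have lt1s := ltn_trans lt12 lt2s.
apply/and4P; split.
- by apply/forallP => -[[|[|[|]]] ?] //; apply/forallP => -[[|[|[|]]] ?]; rewrite !ffunE.
- by apply/forallP => -[[|[|]] ?] //; apply/forallP => -[[|[|]] ?]; rewrite !ffunE.
- apply/forallP => -[[|[|]] ?] //; apply/forallP => -[[|[|[|]]] ?] //=.
    by rewrite !ffunE theta_pos /=.
  by rewrite !ffunE theta_pos /=.
- apply/forallP => -[[|[|[|]]] ?] //; apply/forallP => -[[|[|[|]]] ?] //=.
  by rewrite !ffunE hat_theta /=.
Qed.

(** * Counting by doubling *)

Definition succ_bounded n : {set 'S_n} := [set s : 'S_n | [forall x, s x <= x.+1]].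

Lemma avoid_count_succ_bounded n :
  avoid_count n (@ArrowPattern 3 [:: 2; 1] [:: (1, 3)] isT) = #|succ_bounded n|.
Proof.
rewrite -(card_imset _ (@theta_inj n)); apply: eq_card => p.
rewrite inE -[p](f_invF (@theta_inj n)) contains_theta negbK.
by rewrite mem_imset ?inE //; apply: theta_inj.
Qed.

Lemma lift_perm_inj n (i j : 'I_n.+1) : injective (lift_perm i j).
Proof.
move=> s t /permP e; apply/permP => k.
by apply: (@lift_inj _ j); rewrite -!(lift_perm_lift i) e.
Qed.

Lemma lift_perm_onto n (i j : 'I_n.+1) (s : 'S_n.+1) :
  s i = j -> exists t, s = lift_perm i j t.
Proof.
move=> sij.
have lift_s k : exists k', s (lift i k) = lift j k'.
  case: (unliftP j (s (lift i k))) => [k' -> | e]; first by exists k'.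
  by have /eqP := neq_lift i k; case; apply: (@perm_inj _ s); rewrite e.
pose f k := odflt k (unlift j (s (lift i k))).
have fE k : lift j (f k) = s (lift i k).
  by rewrite /f; have [k' ->] := lift_s k; rewrite liftK.
have f_inj : injective f.
  by move=> k l /(congr1 (lift j)); rewrite !fE => /perm_inj/lift_inj.
exists (perm f_inj); apply/permP => k; case: (unliftP i k) => [l ->|->].
  by rewrite lift_perm_lift permE fE.
by rewrite lift_perm_id.
Qed.

(** Deleting the fixed top point changes no other argument or value, so the bound transfers both
    ways. *)
Lemma card_succ_bounded_fix n :
  #|[set s in succ_bounded n.+1 | s ord_max == ord_max]| = #|succ_bounded n|.
Proof.
rewrite -(card_imset _ (@lift_perm_inj n ord_max ord_max)).
have bE (t : 'S_n) :
    (lift_perm ord_max ord_max t \in succ_bounded n.+1) = (t \in succ_bounded n).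
  rewrite !inE; apply/forallP/forallP => b k.
    by have := b (lift ord_max k); rewrite lift_perm_lift !lift_max.
  case: (unliftP ord_max k) => [l ->|->]; last by rewrite lift_perm_id.
  by rewrite lift_perm_lift !lift_max.
apply: eq_card => s; rewrite in_set; apply/andP/imsetP => [[sb /eqP]|[t tb ->]].
  by case/lift_perm_onto => t es; exists t; rewrite // -bE -es.
by rewrite bE lift_perm_id.
Qed.

Lemma card_succ_bounded n : #|succ_bounded n.+1| = 2 ^ n.
Proof.
elim: n => [|n IH].
  apply/eqP/cards1P; exists 1%g.
  apply/setP => s; rewrite !inE; apply/idP/eqP => [_|->].
    by apply/permP => x; rewrite !ord1.
  by apply/forallP => x; rewrite perm1.
pose m : 'I_n.+2 := inord n; have mE : m = n :> nat by rewrite inordK.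
have mmax : m != ord_max by rewrite -val_eqE /= mE; lia.
pose F := [set s in succ_bounded n.+2 | s ord_max == ord_max].
pose c : 'S_n.+2 := tperm m ord_max.
(* At the two largest arguments the bound holds for every value, so swapping them first is
   harmless. *)
have cb s : s \in succ_bounded n.+2 -> (c * s)%g \in succ_bounded n.+2.
  rewrite !inE => /forallP b; apply/forallP => x; rewrite permM.
  case: tpermP => [->|->|_ _] //=; first by rewrite mE -ltnS.
  exact: ltnW (ltn_ord _).
have cc s : (c * (c * s) = s)%g by rewrite mulgA tperm2 mul1g.
have -> : succ_bounded n.+2 = F :|: [set (c * s)%g | s in F].
  apply/setP => s; rewrite in_setU; apply/idP/orP => [b|[|/imsetP[t]]]; first last.
  - by rewrite inE => /andP[/cb tb _] ->.
  - by rewrite inE => /andP[].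
  have [e|ne] := eqVneq (s ord_max) ord_max; [left | right]; first by rewrite inE b e eqxx.
  apply/imsetP; exists (c * s)%g; rewrite // inE cb //= permM tpermR.
  (* The bound lets only [m] and [ord_max] map to [ord_max], and [ord_max] is excluded. *)
  pose x := (s^-1)%g ord_max; have sx : s x = ord_max by rewrite permKV.
  suff <- : x = m by rewrite sx.
  have nx : x != n.+1 :> nat.
    apply: contra ne => /eqP ex; have e : x = ord_max by apply: val_inj.
    by rewrite -{1}e sx.
  move: b; rewrite inE => /forallP/(_ x); rewrite sx /= => lex.
  by apply: ord_inj; move: lex nx (ltn_ord x); rewrite mE; lia.
rewrite cardsU card_imset; last exact: mulgI.
rewrite (_ : F :&: _ = set0) ?cards0 ?subn0.
  by rewrite card_succ_bounded_fix IH expnS mul2n addnn.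
(* A common element would make [t] send both [m] and [ord_max] to [ord_max]. *)
apply/setP => s; rewrite !inE; apply/negP => /andP[/andP[_ /eqP e] /imsetP[t]].
rewrite inE => /andP[_ /eqP te] es; move: e; rewrite es permM tpermR => e.
by case/eqP: mmax; apply: (@perm_inj _ t); rewrite e te.
Qed.

Theorem theorem4p5 (n : nat) (n_ge1 : 1 <= n) :
  avoid_count n (@ArrowPattern 3 [:: 2; 1] [:: (1, 3)] isT) = 2 ^ (n - 1).
Proof.
rewrite avoid_count_succ_bounded; case: n n_ge1 => // n _.
by rewrite card_succ_bounded subn1.
Qed.
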